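(* Let $k$ be an algebraically closed field of characteristic $0$, let $p<q$ be two prime numbers, and let $A$ be a semisimple Hopf algebra over $k$ of dimension $pq$. If the dual Hopf algebra $A^*$ is of Frobenius type, then either $|G(A)|=p$ and $q\equiv 1\pmod p$, or $|G(A)|=pq$.
   Context: $G(A)$ denotes the group of grouplike elements of the Hopf algebra $A$. A finite-dimensional semisimple Hopf algebra $H$ over $k$ is of Frobenius type if the dimension of every irreducible representation of $H$ divides $\dim_k H$. (Over an algebraically closed field of characteristic $0$, a finite-dimensional Hopf algebra is semisimple if and only if its dual is semisimple.) *)

(* Defs.v *)
From HB Require Import structures.
From mathcomp Require Import all_boot all_order all_algebra all_field.
From mathcomp Require Import classical_sets cardinality.

Set Implicit Arguments.
Unset Strict Implicit.
Unset Printing Implicit Defensive.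
Import GRing.Theory.
Local Open Scope ring_scope.

(* U (x) V is modelled by coordinate matrices with respect to the library's
   bases vbasis {:U} and vbasis {:V}.  The universal property is given by
   tlift_pure, linear_tlift and tlift_eta below: tlift f is the linear map on
   the tensor product induced by a bilinear f. *)
Definition tensor (k : fieldType) (U V : vectType k) : Type :=
  'M[k]_(\dim {:U}, \dim {:V}).
HB.instance Definition _ (k : fieldType) (U V : vectType k) :=
  Vector.copy (tensor U V) 'M[k]_(\dim {:U}, \dim {:V}).

Section Tensor.
Context {k : fieldType} {U V : vectType k}.

Definition pure (u : U) (v : V) : tensor U V :=
  \matrix_(i, j) (coord (vbasis {:U}) i u * coord (vbasis {:V}) j v).

(* Sweedler notation: if t = sum t1 (x) t2, then tlift f t = sum f(t1, t2). *)
Definition tlift {W : lmodType k} (f : U -> V -> W) (t : tensor U V) : W :=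
  \sum_i \sum_j t i j *: f (vbasis {:U})`_i (vbasis {:V})`_j.

Definition bilin {W : lmodType k} (f : U -> V -> W) : Prop :=
  (forall v, linear (f^~ v)) /\ (forall u, linear (f u)).

Lemma eq_tlift (W : lmodType k) (f g : U -> V -> W) t :
  (forall u v, f u v = g u v) -> tlift f t = tlift g t.
Proof. by move=> fg; do 2!apply: eq_bigr => ? _; rewrite fg. Qed.

Lemma linear_tlift (W : lmodType k) (f : U -> V -> W) : linear (tlift f).
Proof.
move=> a s t; rewrite /tlift scaler_sumr -big_split; apply: eq_bigr => i _ /=.
rewrite scaler_sumr -big_split; apply: eq_bigr => j _ /=.
by rewrite !mxE scalerDl scalerA.
Qed.

HB.instance Definition _ (W : lmodType k) (f : U -> V -> W) :=
  GRing.isLinear.Build k (tensor U V) W _ (tlift f) (linear_tlift f).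

Lemma linear_sumP (X Y : lmodType k) (h : X -> Y) (I : finType) (c : I -> k) x :
  linear h -> h (\sum_i c i *: x i) = \sum_i c i *: h (x i).
Proof.
move=> hl; elim/big_rec2: _ => [|i y z _ <-]; last exact: hl.
have := hl (-1) 0 0; rewrite scaleN1r oppr0 addr0 => ->.
by rewrite scaleN1r addNr.
Qed.

Lemma tlift_pure (W : lmodType k) (f : U -> V -> W) u v :
  bilin f -> tlift f (pure u v) = f u v.
Proof.
case=> fl fr.
rewrite [in RHS](coord_vbasis (memvf u)) (linear_sumP _ _ (fl v)).
apply: eq_bigr => i _.
rewrite [in RHS](coord_vbasis (memvf v)) (linear_sumP _ _ (fr _)) scaler_sumr.
by apply: eq_bigr => j _; rewrite mxE scalerA.
Qed.

Lemma bilin_pure : bilin pure.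
Proof.
split=> [v a u u'|u a v v']; apply/matrixP=> i j; rewrite !mxE linearP /=.
  by rewrite mulrDl mulrA.
by rewrite mulrDr mulrCA.
Qed.

Lemma tlift_eta (t : tensor U V) : tlift pure t = t.
Proof.
apply/matrixP=> i j; rewrite /tlift summxE (bigD1 i) //= summxE (bigD1 j) //=.
have co n (X : n.-tuple U) (x y : 'I_n) : free X -> coord X x X`_y = (x == y)%:R.
  by move=> fX; rewrite coord_free // eq_sym.
have co' n (X : n.-tuple V) (x y : 'I_n) : free X -> coord X x X`_y = (x == y)%:R.
  by move=> fX; rewrite coord_free // eq_sym.
have fU := basis_free (vbasisP {:U}); have fV := basis_free (vbasisP {:V}).
rewrite big1 ?addr0 => [|j' nj]; last first.
  by rewrite !mxE co' // (eq_sym j) (negPf nj) !mulr0.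
rewrite big1 ?addr0 => [|i' ni]; last first.
  rewrite summxE big1 // => j' _.
  by rewrite !mxE co // (eq_sym i) (negPf ni) mul0r mulr0.
by rewrite !mxE co // co' // !eqxx !mulr1.
Qed.

Lemma tlift_comp (W W' : lmodType k) (f : U -> V -> W) (h : W -> W') t :
  linear h -> h (tlift f t) = tlift (fun u v => h (f u v)) t.
Proof.
move=> hl; rewrite /tlift; have hs (I : finType) (x : I -> W) :
    h (\sum_i x i) = \sum_i h (x i).
  have := linear_sumP (fun=> 1) x hl.
  by under eq_bigr do rewrite scale1r; under [in RHS]eq_bigr do rewrite scale1r.
rewrite hs; apply: eq_bigr => i _; exact: linear_sumP.
Qed.

Lemma tlift_comb (W : lmodType k) (f g : U -> V -> W) a t :
  tlift (fun u v => a *: f u v + g u v) t = a *: tlift f t + tlift g t.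
Proof.
rewrite /tlift scaler_sumr -big_split; apply: eq_bigr => i _ /=.
rewrite scaler_sumr -big_split; apply: eq_bigr => j _ /=.
by rewrite scalerDr !scalerA mulrC.
Qed.

End Tensor.

Notation "u ⊗ v" := (pure u v) (at level 40, left associativity) : ring_scope.

Lemma tlift_exch (k : fieldType) (U V U' V' : vectType k) (W : lmodType k)
    (F : U -> V -> U' -> V' -> W) (t : tensor U V) (s : tensor U' V') :
  tlift (fun u v => tlift (F u v) s) t =
  tlift (fun u' v' => tlift (fun u v => F u v u' v') t) s.
Proof.
rewrite /tlift; under eq_bigr do under eq_bigr do rewrite scaler_sumr.
under eq_bigr do rewrite exchange_big; rewrite exchange_big /=.
apply: eq_bigr => i' _.
under eq_bigr do under eq_bigr do rewrite scaler_sumr.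
under eq_bigr do rewrite exchange_big; rewrite exchange_big /=.
apply: eq_bigr => j' _; rewrite scaler_sumr; apply: eq_bigr => i _.
rewrite scaler_sumr; apply: eq_bigr => j _.
by rewrite !scalerA mulrC.
Qed.

HB.mixin Record Falgebra_isHopf (k : fieldType) A of Falgebra k A := {
  comul : 'Hom(A, tensor A A);
  counit : 'Hom(A, k^o);
  antipode : 'End(A);
  comulA : forall x : A,
    tlift (fun x1 x2 => tlift (fun y1 y2 => y1 ⊗ (y2 ⊗ x2)) (comul x1))
          (comul x) =
    tlift (fun x1 x2 => x1 ⊗ comul x2) (comul x);
  comul_counitl : forall x : A,
    tlift (fun x1 x2 => counit x1 *: x2) (comul x) = x;
  comul_counitr : forall x : A,
    tlift (fun x1 x2 => counit x2 *: x1) (comul x) = x;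
  comul1 : comul 1 = 1 ⊗ 1;
  comulM : forall x y : A,
    comul (x * y) =
    tlift (fun x1 x2 => tlift (fun y1 y2 => (x1 * y1) ⊗ (x2 * y2)) (comul y))
          (comul x);
  counit1 : counit 1 = 1;
  counitM : forall x y : A, counit (x * y) = counit x * counit y;
  antipodel : forall x : A,
    tlift (fun x1 x2 => antipode x1 * x2) (comul x) = counit x *: 1;
  antipoder : forall x : A,
    tlift (fun x1 x2 => x1 * antipode x2) (comul x) = counit x *: 1
}.

#[short(type="hopfAlgType")]
HB.structure Definition HopfAlgebra (k : fieldType) :=
  { A of Falgebra k A & Falgebra_isHopf k A }.

(* The dual Hopf algebra A^*: all structure maps are transposes.  The product is
   convolution, (f * g)(x) = sum f(x1) g(x2), with unit the counit of A; the
   coproduct, counit and antipode are f |-> f(xy), f |-> f(1) and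
   f |-> f o antipode. *)
Definition hopf_dual (k : fieldType) (A : hopfAlgType k) : Type := 'Hom(A, k^o).
HB.instance Definition _ (k : fieldType) (A : hopfAlgType k) :=
  Vector.copy (hopf_dual A) 'Hom(A, k^o).

Section DualSep.
Context {k : fieldType} {A : vectType k}.
Local Notation D := 'Hom(A, k^o).

Definition tev (W : vectType k) (x : A) (g : D) (w : W) : W := (g x : k) *: w.

Lemma bilin_tev (W : vectType k) x : bilin (@tev W x).
Proof.
split=> [w a g g'|g a w w']; rewrite /tev.
  by rewrite add_lfunE scale_lfunE scalerDl scalerA.
by rewrite scalerDr !scalerA mulrC.
Qed.

Lemma tev_inj (W : vectType k) (t s : tensor D W) :
  (forall x, tlift (tev x) t = tlift (tev x) s) -> t = s.
Proof.
move=> ts; apply/eqP; rewrite -subr_eq0; apply/eqP.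
have {ts} : forall x, tlift (tev x) (t - s) = 0.
  by move=> x; rewrite linearB /= ts subrr.
move: {t s}(t - s) => t t0; apply/matrixP=> i j; rewrite [RHS]mxE.
have fD := basis_free (vbasisP {:D}); have fW := basis_free (vbasisP {:W}).
suff H : \sum_i t i j *: (vbasis {:D})`_i = 0.
  by move/freeP: fD => /(_ (fun i => t i j) H i).
apply/lfunP=> x; rewrite sum_lfunE zero_lfunE.
have := t0 x; rewrite /tlift exchange_big /= /tev.
under eq_bigr do (under eq_bigr do rewrite scalerA); move=> H.
under eq_bigr do rewrite scale_lfunE.
move/freeP: fW => fW.
apply: (fW (fun j => \sum_i t i j * ((vbasis {:D})`_i x : k))).
by rewrite -[RHS]H; apply: eq_bigr => j' _; rewrite scaler_suml.
Qed.
End DualSep.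

Section DualHopf.
Context {k : fieldType} {A : hopfAlgType k}.
Local Notation D := 'Hom(A, k^o).
Implicit Types (f g h : D) (x y z : A).

Definition tscal f g (x y : A) : k^o := f x * g y.

Lemma bilin_tscal f g : bilin (tscal f g).
Proof.
split=> [v a u u'|u a v v']; rewrite /tscal linearP /=.
  by rewrite mulrDl -scalerAl.
by rewrite mulrDr -scalerAr.
Qed.

Definition dmul f g : D := linfun (tlift (tscal f g) \o comul).

Lemma dmulE f g x : dmul f g x = tlift (tscal f g) (comul x).
Proof. by rewrite lfunE. Qed.

Lemma dmulA : associative dmul.
Proof.
move=> f g h; apply/lfunP=> x; rewrite !dmulE.
pose F (a : A) (t : tensor A A) : k^o := f a * tlift (tscal g h) t.
have bF : bilin F.
  split=> [v a u u'|u a v v']; rewrite /F linearP /=.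
    by rewrite mulrDl -scalerAl.
  by rewrite mulrDr -scalerAr.
have := congr1 (tlift F) (comulA x).
rewrite !(tlift_comp _ _ (linear_tlift F)).
under eq_tlift do rewrite (tlift_comp _ _ (linear_tlift F)).
under eq_tlift do under eq_tlift do rewrite tlift_pure // /F (tlift_pure _ _ (bilin_tscal g h)).
under [RHS]eq_tlift do rewrite tlift_pure // /F -dmulE.
rewrite -/(tscal f (dmul g h)) => <-.
apply: eq_tlift => u v; rewrite /tscal dmulE.
have lin : linear (fun c : k^o => (c * h v : k^o)).
  by move=> a b c; rewrite mulrDl -scalerAl.
rewrite (tlift_comp _ _ lin).
by apply: eq_tlift => u' v'; rewrite /tscal mulrA.
Qed.

Lemma dmul1l : left_id (counit : D) dmul.
Proof.
move=> f; apply/lfunP=> x; rewrite dmulE.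
have lin : linear f by exact: linearP.
rewrite -[in RHS](comul_counitl x) (tlift_comp _ _ lin).
by apply: eq_tlift => u v; rewrite linearZ.
Qed.

Lemma dmul1r : right_id (counit : D) dmul.
Proof.
move=> f; apply/lfunP=> x; rewrite dmulE.
have lin : linear f by exact: linearP.
rewrite -[in RHS](comul_counitr x) (tlift_comp _ _ lin).
by apply: eq_tlift => u v; rewrite linearZ /tscal mulrC.
Qed.

Lemma dmul_linl g : linear (dmul^~ g).
Proof.
move=> a f f'; apply/lfunP=> x; rewrite add_lfunE scale_lfunE !dmulE -tlift_comb.
by apply: eq_tlift => u v; rewrite /tscal add_lfunE scale_lfunE mulrDl -scalerAl.
Qed.

Lemma dmul_linr f : linear (dmul f).
Proof.
move=> a g g'; apply/lfunP=> x; rewrite add_lfunE scale_lfunE !dmulE -tlift_comb.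
by apply: eq_tlift => u v; rewrite /tscal add_lfunE scale_lfunE mulrDr -scalerAr.
Qed.

Lemma dmulDl : left_distributive dmul +%R.
Proof. by move=> f f' g; have := dmul_linl g 1 f f'; rewrite !scale1r. Qed.

Lemma dmulDr : right_distributive dmul +%R.
Proof. by move=> f g g'; have := dmul_linr f 1 g g'; rewrite !scale1r. Qed.

Lemma counit_neq0 : (counit : D) != 0.
Proof.
apply/eqP=> /lfunP/(_ 1); rewrite counit1 zero_lfunE => /eqP.
by rewrite oner_eq0.
Qed.

Lemma dmulZl a f g : a *: dmul f g = dmul (a *: f) g.
Proof.
have := dmul_linl g a f 0; rewrite addr0 => ->.
by have := dmul_linl g (-1) 0 0; rewrite scaleN1r oppr0 addr0 => ->;
   rewrite scaleN1r addNr addr0.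
Qed.

Lemma dmulZr a f g : a *: dmul f g = dmul f (a *: g).
Proof.
have := dmul_linr f a g 0; rewrite addr0 => ->.
by have := dmul_linr f (-1) 0 0; rewrite scaleN1r oppr0 addr0 => ->;
   rewrite scaleN1r addNr addr0.
Qed.

HB.instance Definition _ := GRing.Zmodule_isNzRing.Build (hopf_dual A)
  dmulA dmul1l dmul1r dmulDl dmulDr counit_neq0.
HB.instance Definition _ := GRing.Lmodule_isLalgebra.Build k (hopf_dual A)
  dmulZl.
HB.instance Definition _ := GRing.Lalgebra_isAlgebra.Build k (hopf_dual A)
  dmulZr.
HB.instance Definition _ := Algebra_isFalgebra.Build k (hopf_dual A).

Local Notation E := (vbasis {:A}).

(* The transpose of the multiplication: dcomul f = sum f(e_i e_j) e^i (x) e^j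
   with (e^i) the dual basis of (e_i); see dcomulE. *)
Definition dual_basis (i : 'I_(\dim {:A})) : D :=
  linfun (coord E i : A -> k^o).

Definition dcomul_fun f : tensor D D :=
  \sum_(i < \dim {:A}) \sum_(j < \dim {:A})
    (f (E`_i * E`_j) : k) *: (dual_basis i ⊗ dual_basis j).

Lemma dcomul_fun_linear : linear dcomul_fun.
Proof.
move=> a f g; rewrite /dcomul_fun scaler_sumr -big_split; apply: eq_bigr => i _ /=.
rewrite scaler_sumr -big_split; apply: eq_bigr => j _ /=.
by rewrite add_lfunE scale_lfunE scalerDl scalerA.
Qed.

HB.instance Definition _ :=
  GRing.isLinear.Build k D (tensor D D) _ dcomul_fun dcomul_fun_linear.

Definition dcomul : 'Hom(D, tensor D D) := linfun dcomul_fun.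

Lemma dcomulE f x y : tlift (tev x) (dcomul f) y = f (x * y).
Proof.
rewrite lfunE /= /dcomul_fun linear_sum sum_lfunE.
rewrite [in RHS](coord_vbasis (memvf x)) mulr_suml linear_sum.
apply: eq_bigr => i _.
rewrite linear_sum sum_lfunE /=.
rewrite -scalerAl [in RHS](coord_vbasis (memvf y)) mulr_sumr scaler_sumr linear_sum.
apply: eq_bigr => j _.
rewrite linearZ /= tlift_pure; last exact: bilin_tev.
rewrite /tev !scale_lfunE !lfunE /= -scalerAr !linearZ /=.
by congr (_ *: _); exact: mulrC.
Qed.

Lemma dcomulE2 f x y : tlift (fun g h => g x * h y : k^o) (dcomul f) = f (x * y).
Proof.
have lin : linear (fun g : D => g y).
  by move=> a g g'; rewrite add_lfunE scale_lfunE.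
rewrite -dcomulE (tlift_comp _ _ lin).
by apply: eq_tlift => g h; rewrite /tev scale_lfunE.
Qed.

Definition dcounit_fun f : k^o := f 1.

Lemma dcounit_fun_linear : linear dcounit_fun.
Proof. by move=> a f g; rewrite /dcounit_fun add_lfunE scale_lfunE. Qed.

HB.instance Definition _ :=
  GRing.isLinear.Build k D k^o _ dcounit_fun dcounit_fun_linear.

Definition dcounit : 'Hom(D, k^o) := linfun dcounit_fun.

Definition dantipode_fun f : D := (f \o antipode)%VF.

Lemma dantipode_fun_linear : linear dantipode_fun.
Proof.
by move=> a f g; rewrite /dantipode_fun comp_lfunDl comp_lfunZl.
Qed.

HB.instance Definition _ :=
  GRing.isLinear.Build k D D _ dantipode_fun dantipode_fun_linear.

Definition dantipode : 'End(D) := linfun dantipode_fun.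

Lemma dantipodeE f x : dantipode f x = f (antipode x).
Proof. by rewrite lfunE /= comp_lfunE. Qed.

Lemma dcounitE f : dcounit f = f 1. Proof. by rewrite lfunE. Qed.

Lemma linear_eval x : linear (fun f => f x).
Proof. by move=> a f g; rewrite add_lfunE scale_lfunE. Qed.

Lemma linear_tev (W : vectType k) x : linear (tlift (@tev _ _ W x)).
Proof. exact: linear_tlift. Qed.

Lemma tev_pure (W : vectType k) x f (w : W) :
  tlift (tev x) (f ⊗ w) = (f x : k) *: w.
Proof. by rewrite tlift_pure //; exact: bilin_tev. Qed.

Lemma dcomulA f :
  tlift (fun f1 f2 => tlift (fun g1 g2 => g1 ⊗ (g2 ⊗ f2)) (dcomul f1))
        (dcomul f) =
  tlift (fun f1 f2 => f1 ⊗ dcomul f2) (dcomul f).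
Proof.
apply: tev_inj => x; rewrite !(tlift_comp _ _ (linear_tev x)).
under eq_tlift do rewrite (tlift_comp _ _ (linear_tev x)).
under eq_tlift do under eq_tlift do rewrite tev_pure.
under [in RHS]eq_tlift do rewrite tev_pure.
apply: tev_inj => y; rewrite !(tlift_comp _ _ (linear_tev y)).
under eq_tlift do rewrite (tlift_comp _ _ (linear_tev y)).
under eq_tlift do under eq_tlift do rewrite linearZ /= tev_pure.
apply/lfunP=> z.
transitivity (tlift (tev (x * y)) (dcomul f) z).
  congr (fun_of_lfun _ z); apply: eq_tlift => g h.
  rewrite /tev -dcomulE2.
  have lin : linear (fun c : k^o => (c : k) *: h).
    by move=> a b c; rewrite scalerDl -scalerA.
  by rewrite (tlift_comp _ _ lin); apply: eq_tlift => u v; rewrite scalerA.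
rewrite dcomulE -mulrA -(dcomulE f x) -(dcomulE _ y z).
have lin : linear (fun g => (dcomul g)) by exact: linearP.
rewrite !(tlift_comp _ _ lin, tlift_comp _ _ (linear_tev y)).
by congr (fun_of_lfun _ z); apply: eq_tlift => u v; rewrite /tev !linearZ.
Qed.

Lemma dcomul_counitl f :
  tlift (fun f1 f2 => (dcounit f1 : k) *: f2) (dcomul f) = f.
Proof.
apply/lfunP=> y; rewrite -[in RHS](mul1r y) -dcomulE.
by under eq_tlift do rewrite dcounitE.
Qed.

Lemma dcomul_counitr f :
  tlift (fun f1 f2 => (dcounit f2 : k) *: f1) (dcomul f) = f.
Proof.
apply/lfunP=> y; rewrite -[in RHS](mulr1 y) -dcomulE2.
rewrite (tlift_comp _ _ (linear_eval y)).
by apply: eq_tlift => g h; rewrite dcounitE scale_lfunE; exact: mulrC.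
Qed.

Lemma dcomul1 : dcomul (counit : D) = (counit : D) ⊗ (counit : D).
Proof.
apply: tev_inj => x; apply/lfunP=> y.
by rewrite dcomulE tev_pure scale_lfunE counitM.
Qed.

Lemma dcomulM f g :
  dcomul (dmul f g) =
  tlift (fun f1 f2 =>
    tlift (fun g1 g2 => (dmul f1 g1) ⊗ (dmul f2 g2)) (dcomul g)) (dcomul f).
Proof.
apply: tev_inj => x; apply/lfunP=> y.
rewrite dcomulE dmulE comulM.
rewrite (tlift_comp _ _ (linear_tlift _)).
under eq_tlift do rewrite (tlift_comp _ _ (linear_tlift _)).
under eq_tlift do under eq_tlift do
  rewrite (tlift_pure _ _ (bilin_tscal f g)) /tscal -!dcomulE2.
rewrite (tlift_comp _ _ (linear_tev x)) (tlift_comp _ _ (linear_eval y)).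
under [in RHS]eq_tlift do
  rewrite (tlift_comp _ _ (linear_tev x)) (tlift_comp _ _ (linear_eval y)).
under [in RHS]eq_tlift do under eq_tlift do
  rewrite tev_pure scale_lfunE !dmulE.
have mlin1 (c : k^o) : linear (fun b : k^o => c * b : k^o).
  by move=> a b b'; rewrite mulrDr scalerAr.
have mlin2 (c : k^o) : linear (fun b : k^o => b * c : k^o).
  by move=> a b b'; rewrite mulrDl -scalerAl.
pose G (u v s t : A) (f1 f2 g1 g2 : D) : k^o := (f1 u * g1 v) * (f2 s * g2 t).
transitivity (tlift (fun u v => tlift (fun s t =>
  tlift (fun f1 f2 => tlift (G u v s t f1 f2) (dcomul g)) (dcomul f))
    (comul y)) (comul x)).
  apply: eq_tlift => u v; apply: eq_tlift => s t.
  rewrite (tlift_comp _ _ (mlin2 _)); apply: eq_tlift => f1 f2.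
  rewrite (tlift_comp _ _ (mlin1 _)); apply: eq_tlift => g1 g2.
  by rewrite /G mulrACA.
under eq_tlift do rewrite tlift_exch.
rewrite tlift_exch; apply: eq_tlift => f1 f2.
under eq_tlift do rewrite tlift_exch.
rewrite tlift_exch; apply: eq_tlift => g1 g2.
rewrite [RHS]/(_ *: _) /= (tlift_comp _ _ (mlin2 _)); apply: eq_tlift => u v.
by rewrite (tlift_comp _ _ (mlin1 _)).
Qed.

Lemma dcounit1 : dcounit (counit : D) = 1.
Proof. by rewrite dcounitE counit1. Qed.

Lemma dcounitM f g : dcounit (dmul f g) = dcounit f * dcounit g.
Proof.
by rewrite !dcounitE dmulE comul1 (tlift_pure _ _ (bilin_tscal f g)).
Qed.

Lemma dantipodel f :
  tlift (fun f1 f2 => dmul (dantipode f1) f2) (dcomul f) =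
  (dcounit f : k) *: (counit : D).
Proof.
apply/lfunP=> x; rewrite scale_lfunE dcounitE.
rewrite (tlift_comp _ _ (linear_eval x)).
under eq_tlift do rewrite dmulE.
rewrite tlift_exch.
have -> : f 1 *: (counit : D) x = f ((counit x : k) *: (1 : A)).
  by rewrite linearZ; exact: mulrC.
have lin : linear f by exact: linearP.
rewrite -antipodel (tlift_comp _ _ lin); apply: eq_tlift => u v.
by rewrite -dcomulE2; apply: eq_tlift => g h; rewrite /tscal dantipodeE.
Qed.

Lemma dantipoder f :
  tlift (fun f1 f2 => dmul f1 (dantipode f2)) (dcomul f) =
  (dcounit f : k) *: (counit : D).
Proof.
apply/lfunP=> x; rewrite scale_lfunE dcounitE.
rewrite (tlift_comp _ _ (linear_eval x)).
under eq_tlift do rewrite dmulE.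
rewrite tlift_exch.
have -> : f 1 *: (counit : D) x = f ((counit x : k) *: (1 : A)).
  by rewrite linearZ; exact: mulrC.
have lin : linear f by exact: linearP.
rewrite -antipoder (tlift_comp _ _ lin); apply: eq_tlift => u v.
by rewrite -dcomulE2; apply: eq_tlift => g h; rewrite /tscal dantipodeE.
Qed.

HB.instance Definition _ := Falgebra_isHopf.Build k (hopf_dual A)
  dcomulA dcomul_counitl dcomul_counitr dcomul1 dcomulM dcounit1 dcounitM
  dantipodel dantipoder.

End DualHopf.

(* Semisimplicity of the ring H: its left regular module is semisimple, i.e.
   every left ideal is a direct summand as a left ideal. *)
Definition left_ideal (k : fieldType) (H : falgType k) (I : {vspace H}) : bool :=
  ({:H} * I <= I)%VS.

Definition semisimple_alg (k : fieldType) (H : falgType k) : Prop :=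
  forall I : {vspace H}, left_ideal I ->
  exists J : {vspace H}, [/\ left_ideal J, (I + J = {:H})%VS & (I :&: J = 0)%VS].

Definition representation (k : fieldType) (H : falgType k) (V : vectType k)
    (rho : 'Hom(H, 'End(V))) : Prop :=
  rho 1 = \1%VF /\ (forall x y : H, rho (x * y) = (rho x \o rho y)%VF).

Definition irreducible_rep (k : fieldType) (H : falgType k) (V : vectType k)
    (rho : 'Hom(H, 'End(V))) : Prop :=
  [/\ representation rho, ({:V} != 0)%VS &
      forall U : {vspace V}, (forall x : H, (rho x @: U <= U)%VS) ->
        U = 0%VS \/ U = {:V}%VS].

(* Semisimplicity is part of being of Frobenius type.  An irreducible
   representation of a finite-dimensional algebra is finite-dimensional, so
   letting V range over vectType loses no generality. *)
Definition frobenius_type (k : fieldType) (H : hopfAlgType k) : Prop :=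
  semisimple_alg H /\
  forall (V : vectType k) (rho : 'Hom(H, 'End(V))),
    irreducible_rep rho -> (\dim {:V} %| \dim {:H})%N.

Definition grouplike (k : fieldType) (A : hopfAlgType k) : set A :=
  [set g | comul g = g ⊗ g /\ counit g = 1]%classic.
Arguments grouplike {k} A _.

(* Main.v *)
Require Import Defs.
From HB Require Import structures.
From mathcomp Require Import all_boot all_order all_algebra all_field.
From mathcomp Require Import fingroup perm pgroup boolp finmap.
From mathcomp Require Import classical_sets cardinality.

Set Implicit Arguments.
Unset Strict Implicit.
Unset Printing Implicit Defensive.
Import GRing.Theory.
Local Open Scope ring_scope.

(* The grouplikes of [A] are the one-dimensional representations of [A^*].
   Irreducible representations of [A^*] have dimension dividing [pq], and their
   squares add up to [pq] (Wedderburn, via Burnside's theorem), so the dimensions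
   are 1 and [p] and [pq = n + a p^2] with [n = |G(A)|]. Hence [n = p m] with
   [q = m + a p]: if [m = 1] we are in the first case, and otherwise [m] has a
   prime divisor [r <> p]. By Cauchy there is a grouplike of order [r], so [r]
   divides [pq] and [m = r = q].

   The last divisibility is a special case of Nichols-Zoeller. On [A (x) A] the
   operators [g (x) 1] and [g (x) g] are conjugate, so left multiplication by a
   grouplike has a trace [t] with [t^2 = dim(A) t]; averaging these traces over
   the cyclic group of order [r] gives the rank of an idempotent. *)

(** * Linear maps and separating families of functionals *)

Lemma linfun_linear (k : fieldType) (U V : vectType k) (f : U -> V) :
  linear f -> linfun f =1 f.
Proof.
move=> f_lin; pose fL := GRing.isLinear.Build k U V _ f f_lin.
by pose f' : {linear U -> V} := HB.pack f fL; exact: (lfunE f').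
Qed.

(** Evaluation on a basis of [W] embeds [V] into the row vectors of length [\dim W], so [\dim W] is
    at least the dimension of [V], which is that of the whole dual. *)
Lemma separating_dual_full (k : fieldType) (V : vectType k)
    (W : {vspace 'Hom(V, k^o)}) :
  (forall v, (forall f, f \in W -> f v = 0) -> v = 0) -> W = fullv.
Proof.
move=> W0; apply/eqP; rewrite eqEdim subvf /=.
pose ev v : 'rV[k]_(\dim W) := \row_i ((vbasis W)`_i v : k).
have ev_lin : linear ev.
  by move=> a u v; apply/rowP=> i; rewrite !mxE linearP.
have ker0 : lker (linfun ev) = 0%VS.
  apply/eqP; rewrite -subv0; apply/subvP=> v.
  rewrite memv_ker linfun_linear // memv0 => /eqP/rowP evv.
  apply/eqP/W0 => f /coord_vbasis->; rewrite sum_lfunE big1 // => i _.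
  by have := evv i; rewrite !mxE scale_lfunE => ->; rewrite scaler0.
have := limg_ker_dim (linfun ev) {:V}.
rewrite ker0 capv0 dimv0 add0n => dimV.
have : (\dim {:V} <= \dim W)%N.
  by rewrite -dimV (leq_trans (dimvS (subvf _))) // dimvf /dim /= mul1n.
by apply: leq_trans; rewrite !dimvf /dim /= muln1.
Qed.

(** * Burnside's theorem on irreducible operator algebras *)

(** As [W] is nonzero, the characteristic polynomial of [f] restricted to [W] is not constant, so it
    has a root in the closed field. *)
Lemma invariant_eigenvector (k : closedFieldType) (V : vectType k)
    (f : 'End(V)) (W : {vspace V}) :
  W != 0%VS -> (f @: W <= W)%VS ->
  exists a w, [/\ w \in W, w != 0 & f w = a *: w].
Proof.
move=> W0 fW; set e := vbasis W.
have fe : free e := basis_free (vbasisP W).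
(* The rows of [M] hold the coordinates of the images, so a row eigenvector [v] lists the
   coordinates of an eigenvector of [f]. *)
pose M : 'M[k]_(\dim W) := \matrix_(i, j) coord e j (f e`_i).
have /closed_rootP[a] : size (char_poly M) != 1%N.
  by rewrite size_char_poly eqSS dimv_eq0.
rewrite -eigenvalue_root_char => /eigenvalueP[v vM v0].
exists a, (\sum_i v 0 i *: e`_i); split.
- by apply: memv_suml => i _; rewrite memvZ // vbasis_mem ?mem_nth ?size_tuple.
- apply: contraNneq v0 => ve; apply/eqP/rowP=> i; rewrite mxE.
  by move/freeP: fe => /(_ (fun i => v 0 i) ve).
rewrite linear_sum scaler_sumr /=.
have fE (i : 'I_(\dim W)) : f e`_i = \sum_j M i j *: e`_j.
  under eq_bigr do rewrite mxE; apply: coord_vbasis.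
  by apply: (subvP fW); rewrite memv_img // vbasis_mem ?mem_nth ?size_tuple.
under eq_bigr do rewrite linearZ /= fE scaler_sumr.
rewrite exchange_big; apply: eq_bigr => j _ /=.
have /rowP/(_ j) := vM; rewrite !mxE scalerA => <-.
by rewrite scaler_suml; apply: eq_bigr => i _; rewrite scalerA.
Qed.

Section Burnside.
Context {k : closedFieldType} {V : vectType k} (S : {vspace 'End(V)}).
Hypothesis S_comp : {in S &, forall f g, (f \o g)%VF \in S}.
Hypothesis S_trans : forall v w, v != 0 -> exists2 f, f \in S & f v = w.

(* Lomonosov and Rosenthal: if [T \in S] has minimal nonzero rank and rank at
   least 2, then [T R T - a T] has smaller nonzero rank for suitable [R] and an
   eigenvalue [a] of [T R] on the image of [T]. *)
Lemma transitive_rank1 :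
  ({:V} != 0)%VS -> exists2 f, f \in S & \dim (limg f) = 1%N.
Proof.
move=> V0; have v0 : vpick {:V} != 0 by rewrite vpick0.
pose P n := `[< exists f, [/\ f \in S, f != 0 & \dim (limg f) = n] >].
have exP : exists n, P n.
  have [f fS fv] := S_trans (vpick {:V}) v0.
  exists (\dim (limg f)); apply/asboolP; exists f; split=> //.
  by apply: contraNneq v0 => f0; rewrite -fv f0 zero_lfunE.
have [n /asboolP[T [TS T0 Tn]] nmin] := ex_minnP exP.
exists T => //; apply/eqP; rewrite eqn_leq; apply/andP; split; last first.
  rewrite lt0n dimv_eq0 -lkerE; apply: contra T0 => /subvP kT.
  by apply/eqP/lfunP=> v; apply/eqP; rewrite zero_lfunE -memv_ker kT ?memvf.
rewrite leqNgt; apply/negP => T1.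
(* As the rank is at least 2, some [T x2] lies off the line of [T x1]. With [R (T x1) = x2], the
   vector [T R T x1 = T x2] is no multiple of [T x1], which will give [T' != 0]. *)
have /lfunPn[x1] := T0; rewrite zero_lfunE => y10.
have /subvPn[_ /memv_imgP[x2 _ ->] y2] : ~~ (limg T <= <[T x1]>)%VS.
  by apply/negP => /dimvS; rewrite dim_vline y10 leqNgt T1.
have [R RS Rx] := S_trans x2 y10.
pose U := (T \o R)%VF.
have limT0 : limg T != 0%VS by rewrite -dimv_eq0 -lt0n (ltn_trans _ T1).
have [a [w [wT w0 Uw]]] : exists a w, [/\ w \in limg T, w != 0 & U w = a *: w].
  apply: invariant_eigenvector => //; apply/subvP=> _ /memv_imgP[u _ ->].
  by rewrite comp_lfunE memv_img ?memvf.
pose F := U - a *: \1%VF; pose T' := (F \o T)%VF.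
have T'E : T' = (T \o (R \o T))%VF - a *: T.
  apply/lfunP=> u.
  by rewrite !(add_lfunE, opp_lfunE, scale_lfunE, comp_lfunE, id_lfunE).
have T'S : T' \in S.
  rewrite T'E rpredB ?memvZ //; apply: S_comp => //; exact: S_comp.
have T'0 : T' != 0.
  apply/lfunPn; exists x1.
  rewrite T'E add_lfunE opp_lfunE scale_lfunE !comp_lfunE Rx zero_lfunE subr_eq0.
  by apply: contraNneq y2 => ->; rewrite memvZ ?memv_line.
have /nmin : P (\dim (limg T')) by apply/asboolP; exists T'.
(* [F] kills the nonzero vector [w] of the image of [T], so [F \o T] has smaller rank than [T]. *)
rewrite -Tn limg_comp -(limg_ker_dim F (limg T)) leqNgt -[X in (X < _)%N]add0n.
rewrite ltn_add2r lt0n dimv_eq0 => /negP; apply.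
apply: contra w0; rewrite -subv0 => /subvP/(_ w).
rewrite memv_cap wT memv0; apply.
by rewrite memv_ker /F add_lfunE opp_lfunE scale_lfunE id_lfunE Uw subrr eqxx.
Qed.

(** A rank-one [T] in [S] has the form [v |-> phi v *: u]. Composing it with elements of [S] on both
    sides turns [phi] into any functional and [u] into any vector, and every operator is a sum of
    such rank-one maps. *)
Lemma transitive_full : S = fullv.
Proof.
have [V0|V0] := eqVneq {:V}%VS 0%VS.
  apply/eqP; rewrite eqEsubv subvf; apply/subvP=> f _.
  suff -> : f = 0 by rewrite mem0v.
  apply/lfunP=> v; have : v \in {:V}%VS by rewrite memvf.
  by rewrite V0 memv0 => /eqP->; rewrite !linear0.
have [T TS T1] := transitive_rank1 V0.
have T0 : limg T != 0%VS by rewrite -dimv_eq0 T1.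
pose u := vpick (limg T); have u0 : u != 0 by rewrite vpick0.
have Tu : limg T = <[u]>%VS.
  apply/esym/eqP; rewrite eqEdim T1 dim_vline u0 leqnn andbT.
  by rewrite -memvE memv_pick.
have [phi Tphi] : exists phi : 'Hom(V, k^o), forall v, T v = phi v *: u.
  have cl : linear (fun v => coord [tuple u] 0 (T v) : k^o).
    by move=> a v w; rewrite !linearP.
  exists (linfun (fun v => coord [tuple u] 0 (T v) : k^o)) => v.
  rewrite linfun_linear //.
  have : T v \in <<[tuple u]>>%VS by rewrite span_seq1 -Tu memv_img ?memvf.
  by move=> /coord_span; rewrite big_ord1.
pose cphi (R : 'End(V)) := (phi \o R)%VF.
have cl : linear cphi by move=> a f g; rewrite /cphi comp_lfunDr -comp_lfunZr.
(* If all [phi \o f] with [f] in [S] killed some [v != 0], then [phi] would vanish on the vectors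
   [f v], which are arbitrary, and [T] would be 0. *)
have cS : (linfun cphi @: S)%VS = fullv.
  apply: separating_dual_full => v H; apply/eqP; apply: contraNT T0 => v0.
  suff -> : T = 0 by rewrite lim0g.
  apply/lfunP=> w; have [f fS fv] := S_trans w v0.
  rewrite zero_lfunE Tphi -fv -(comp_lfunE phi).
  have := H (linfun cphi f) (memv_img _ fS); rewrite linfun_linear // /cphi => ->.
  by rewrite scale0r.
apply/eqP; rewrite eqEsubv subvf; apply/subvP=> f _.
have rank1 (psi : 'Hom(V, k^o)) w :
    exists2 g, g \in S & forall v, g v = psi v *: w.
  have : psi \in (linfun cphi @: S)%VS by rewrite cS memvf.
  move=> /memv_imgP[R RS ->]; have [R' R'S R'u] := S_trans w u0.
  exists (R' \o (T \o R))%VF; first by do 2?apply: S_comp.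
  by move=> v; rewrite [linfun cphi R]linfun_linear // !comp_lfunE Tphi linearZ /= R'u.
suff [g gS gf] : exists2 g, g \in S & g = f by rewrite -gf.
have /choice[g gP] : forall i : 'I_(\dim {:V}), exists g,
    g \in S /\ forall v, g v = coord (vbasis {:V}) i v *: f (vbasis {:V})`_i.
  move=> i; have [g gS gE] :=
    rank1 (linfun (coord (vbasis {:V}) i : V -> k^o)) (f (vbasis {:V})`_i).
  by exists g; split=> // v; rewrite gE lfunE.
exists (\sum_i g i); first by apply: memv_suml => i _; have [] := gP i.
apply/lfunP=> v; rewrite sum_lfunE [in RHS](coord_vbasis (memvf v)) linear_sum.
by apply: eq_bigr => i _; rewrite linearZ /=; have [_ ->] := gP i.
Qed.

End Burnside.

(** * Ideals of a semisimple algebra *)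

Section Representation.
Context {k : fieldType} {B : falgType k}.
Implicit Types (I Q : {vspace B}).

Definition ideal Q := left_ideal Q && (Q * {:B} <= Q)%VS.

Lemma left_idealP I :
  reflect (forall x y, y \in I -> x * y \in I) (left_ideal I).
Proof.
apply: (iffP prodvP) => H x y; last by move=> _; exact: H.
by apply: H; exact: memvf.
Qed.

Lemma idealP Q :
  reflect (forall x y, y \in Q -> x * y \in Q /\ y * x \in Q) (ideal Q).
Proof.
apply: (iffP andP) => [[/left_idealP lQ /prodvP rQ] x y yQ|H].
  by rewrite lQ // rQ // memvf.
split; first by apply/left_idealP => x y /(H x)[].
by apply/prodvP => y x /(H x)[].
Qed.

Lemma ideal_lker_rep (V : vectType k) (rho : 'Hom(B, 'End(V))) :
  representation rho -> ideal (lker rho).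
Proof.
move=> [_ rhoM]; apply/idealP=> x y; rewrite !memv_ker !rhoM => /eqP->.
by rewrite comp_lfun0l comp_lfun0r eqxx.
Qed.

Lemma ideal_cap Q Q' : ideal Q -> ideal Q' -> ideal (Q :&: Q').
Proof.
move=> /idealP iQ /idealP iQ'; apply/idealP=> x y; rewrite !memv_cap.
by move=> /andP[/(iQ x)[-> ->] /(iQ' x)[-> ->]].
Qed.

Definition alg_char (f : 'Hom(B, k^o)) : Prop :=
  f 1 = 1 /\ {morph f : x y / x * y}.

Lemma ideal_lker_char f : alg_char f -> ideal (lker f).
Proof.
move=> [_ fM]; apply/idealP=> x y; rewrite !memv_ker !fM => /eqP->.
by rewrite mul0r mulr0 eqxx.
Qed.

(** The projection [vsproj] makes the formula total; it changes nothing once [I] is a left ideal. *)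
Definition lid_rep I : 'Hom(B, 'End(subvs_of I)) :=
  linfun (fun x => linfun (vsproj I \o *%R x \o vsval)).

Lemma lid_repE I x v : left_ideal I -> vsval (lid_rep I x v) = x * vsval v.
Proof.
move=> /left_idealP lI.
have lin y : linear (vsproj I \o *%R y \o (vsval : subvs_of I -> B)).
  by move=> a u w /=; rewrite mulrDr -scalerAr vsproj_is_linear.
rewrite linfun_linear => [|a y z].
  by rewrite linfun_linear // [LHS]vsprojK // lI ?subvsP.
apply/lfunP=> w; rewrite add_lfunE scale_lfunE !linfun_linear //=.
by rewrite mulrDl -scalerAl linearP.
Qed.

Lemma lid_rep_representation I : left_ideal I -> representation (lid_rep I).
Proof.
move=> lI; split=> [|x y]; apply/lfunP=> v; apply: subvs_inj.
  by rewrite lid_repE // id_lfunE mul1r.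
by rewrite comp_lfunE !lid_repE // mulrA.
Qed.

Definition minimal_left_ideal I :=
  [/\ left_ideal I, I != 0%VS
    & forall J, left_ideal J -> J != 0%VS -> (J <= I)%VS -> J = I].

Lemma exists_minimal_left_ideal Q : left_ideal Q -> Q != 0%VS ->
  exists2 I, minimal_left_ideal I & (I <= Q)%VS.
Proof.
move=> lQ Q0.
pose P n := `[< exists I, [/\ left_ideal I, I != 0%VS, (I <= Q)%VS & \dim I = n] >].
have exP : exists n, P n by exists (\dim Q); apply/asboolP; exists Q.
have [n /asboolP[I [lI I0 IQ In]] nmin] := ex_minnP exP.
exists I => //; split=> // J lJ J0 JI; apply/eqP; rewrite eqEdim JI In nmin //.
by apply/asboolP; exists J; split=> //; apply: subv_trans IQ.
Qed.

Lemma dim_subvs I : \dim {:subvs_of I} = \dim I.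
Proof. by rewrite dimvf. Qed.

(** Seen inside [B], a stable subspace is a left ideal contained in [I], so minimality leaves only 0
    and [I]. *)
Lemma lid_rep_irreducible I :
  minimal_left_ideal I -> irreducible_rep (lid_rep I).
Proof.
move=> [lI I0 Imin]; split; first exact: lid_rep_representation.
  by rewrite -dimv_eq0 dim_subvs dimv_eq0.
move=> U Ustab; pose val := linfun (vsval : subvs_of I -> B).
have valE v : val v = vsval v by rewrite lfunE.
have valI : (val @: U <= I)%VS.
  by apply/subvP=> _ /memv_imgP[u _ ->]; rewrite valE subvsP.
have lU : left_ideal (val @: U).
  apply/left_idealP=> x _ /memv_imgP[u uU ->].
  rewrite valE -lid_repE // -valE memv_img //.
  by apply: (subvP (Ustab x)); rewrite memv_img.
have val0 : lker val == 0%VS.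
  by apply/lker0P => u v; rewrite !valE => /subvs_inj.
have [U0|U0] := eqVneq (val @: U)%VS 0%VS; [left|right].
  by apply/eqP; rewrite -(eq_limg_ker0 _ _ val0) U0 limg0.
apply/eqP; rewrite eqEdim subvf dim_subvs.
have <- : \dim (val @: U) = \dim U by rewrite limg_dim_eq // (eqP val0) capv0.
by rewrite (Imin _ lU U0 valI) leqnn.
Qed.

(* The component [e] of 1 in [I] satisfies [x e = x] on [I], so [e e = e]. *)
Lemma semisimple_left_ideal_sqr I : semisimple_alg B -> left_ideal I ->
  I != 0%VS -> exists2 x, x \in I & lid_rep I x != 0.
Proof.
move=> ssB lI I0; have [J [lJ IJ IJ0]] := ssB I lI.
have : 1 \in (I + J)%VS by rewrite IJ memvf.
case/memv_addP=> e eI [f fJ def1].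
have eR x : x \in I -> x * e = x.
  move=> xI; apply/eqP; rewrite eq_sym -subr_eq0 -memv0 -IJ0 memv_cap.
  have -> : x - x * e = x * f by rewrite -{1}[x]mulr1 def1 mulrDr addrC addKr.
  rewrite [X in _ && X](left_idealP _ lJ) // andbT.
  have -> : x * f = x - x * e by rewrite -{2}[x]mulr1 def1 mulrDr addrC addKr.
  by rewrite rpredB // (left_idealP _ lI).
exists e => //; apply: contraNneq I0 => e0; rewrite -subv0.
apply/subvP=> x xI; rewrite -(eR x xI).
suff -> : e = 0 by rewrite mulr0 mem0v.
have /(congr1 vsval) : lid_rep I e (vsproj I e) = 0 by rewrite e0 zero_lfunE.
by rewrite lid_repE // vsprojK // eR.
Qed.

(** [B] acts on a generator [u] of the line [I] by scalars, [x * u = f x *: u], and associativity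
    makes [f] multiplicative. *)
Lemma line_ideal_char I : left_ideal I -> \dim I = 1%N ->
  exists2 f : 'Hom(B, k^o), alg_char f & lker f = lker (lid_rep I).
Proof.
move=> lI I1; have I0 : I != 0%VS by rewrite -dimv_eq0 I1.
pose u := vpick I; have u0 : u != 0 by rewrite vpick0.
have uI : u \in I := memv_pick I.
have Iu : I = <[u]>%VS.
  by apply/esym/eqP; rewrite eqEdim I1 dim_vline u0 leqnn andbT -memvE.
pose f := linfun (fun x => coord [tuple u] 0 (x * u) : k^o).
have fE x : x * u = (f x : k) *: u.
  rewrite linfun_linear => [|a y z]; last by rewrite mulrDl -scalerAl linearP.
  have : x * u \in <<[tuple u]>>%VS.
    by rewrite span_seq1 -Iu (left_idealP _ lI).
  by move=> /coord_span; rewrite big_ord1.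
have uinj (a b : k) : a *: u = b *: u -> a = b.
  by move/eqP; rewrite -subr_eq0 -scalerBl scaler_eq0 (negPf u0) orbF subr_eq0 => /eqP.
exists f.
  split; first by apply: uinj; rewrite -fE mul1r scale1r.
  by move=> x y; apply: uinj; rewrite -fE -mulrA fE -scalerAr fE scalerA mulrC.
apply/vspaceP=> x; rewrite !memv_ker; apply/eqP/eqP => [fx|rx].
  apply/lfunP=> v; apply: subvs_inj; rewrite lid_repE // zero_lfunE.
  have := subvsP v; rewrite {2}Iu => /vlineP[a ->].
  by rewrite -scalerAr fE fx scale0r scaler0.
apply: uinj; rewrite -fE scale0r -[u](vsprojK uI) -lid_repE // rx.
by rewrite zero_lfunE.
Qed.

(** Pick [x0] in [Q] with [f x0 = 1]. For [x] in [Q], the element [x - f x *: x0] lies in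
    [Q :&: lker f], so [g x = f x * g x0]. Taking [x0 * z] for [x] and cancelling [g x0] gives
    [g z = f z] for every [z]. *)
Lemma alg_char_eq_on_ideal Q (f g : 'Hom(B, k^o)) :
  ideal Q -> alg_char f -> alg_char g ->
  (exists2 x, x \in Q & f x != 0) -> (exists2 x, x \in Q & g x != 0) ->
  (Q :&: lker f <= lker g)%VS -> f = g.
Proof.
move=> /idealP iQ [_ fM] [_ gM] [x1 x1Q fx1] [y yQ gy] /subvP fg.
pose x0 := (f x1 : k)^-1 *: x1.
have x0Q : x0 \in Q by rewrite memvZ.
have fx0 : f x0 = 1 by rewrite linearZ /=; exact: mulVf.
have gE x : x \in Q -> g x = f x * g x0.
  move=> xQ; apply/eqP; rewrite -subr_eq0.
  have -> : g x - f x * g x0 = g (x - (f x : k) *: x0) by rewrite linearB [in RHS]linearZ.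
  rewrite -memv_ker fg // memv_cap memv_ker rpredB ?memvZ //=.
  by rewrite linearB linearZ /= fx0 [_ *: _]mulr1 subrr.
have gx0 : g x0 != 0 by apply: contraNneq gy => gx0; rewrite gE // gx0 mulr0.
apply/lfunP=> z; apply: (mulIf gx0).
have := gE (x0 * z) (iQ z x0 x0Q).2; rewrite gM fM fx0 mul1r => <-.
exact: mulrC.
Qed.

End Representation.

(** * The Wedderburn count over an algebraically closed field *)

Section Closed.
Context {k : closedFieldType} {B : falgType k}.
Implicit Types (I Q : {vspace B}).

(** By Burnside [rho @: Q] is all of ['End(V)], and rank-nullity concludes. For transitivity, the
    vectors killed by [Q] form a proper subrepresentation [N], hence [N = 0]; so for [v != 0] the
    subrepresentation [Q v] is nonzero, hence everything. *)
Lemma irreducible_ideal_dim (V : vectType k) (rho : 'Hom(B, 'End(V))) Q :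
  irreducible_rep rho -> ideal Q -> (exists2 x, x \in Q & rho x != 0) ->
  \dim Q = (\dim {:V} ^ 2 + \dim (Q :&: lker rho))%N.
Proof.
move=> [[rho1 rhoM] V0 irr] /idealP iQ [x0 x0Q rx0].
rewrite addnC -(limg_ker_dim rho Q); congr addn.
suff -> : (rho @: Q)%VS = fullv by rewrite !dimvf /dim /= -mulnn.
apply: transitive_full => [_ _ /memv_imgP[x xQ ->] /memv_imgP[y yQ ->]|v w v0].
  by rewrite -rhoM memv_img //; have [] := iQ x y yQ.
pose N := (\bigcap_(i < \dim Q) lker (rho (vbasis Q)`_i))%VS.
have NP u : reflect (forall x, x \in Q -> rho x u = 0) (u \in N).
  apply: (iffP idP) => [uN x xQ|H].
    rewrite (coord_vbasis xQ) linear_sum sum_lfunE big1 // => i _ /=.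
    rewrite linearZ scale_lfunE /=.
    have /eqP-> : rho (vbasis Q)`_i u == 0.
      by rewrite -memv_ker; apply: (subvP (bigcapv_inf i _ (subvv _))) uN.
    by rewrite scaler0.
  rewrite memvE; apply/subv_bigcapP => i _; rewrite -memvE memv_ker H //.
  by rewrite vbasis_mem ?mem_nth ?size_tuple.
have N0 : N = 0%VS.
  have [x|//|Nfull] := irr N.
    apply/subvP=> _ /memv_imgP[u /NP uN ->]; apply/NP=> y yQ.
    by rewrite -comp_lfunE -rhoM uN //; have [] := iQ x y yQ.
  case/eqP: rx0; apply/lfunP=> u; rewrite zero_lfunE.
  by have /NP -> : u \in N by rewrite Nfull memvf.
pose ev := linfun (fun x : B => rho x v).
have evE x : ev x = rho x v.
  by rewrite linfun_linear // => a y z; rewrite linearP add_lfunE scale_lfunE.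
have [x|ev0|evfull] := irr (ev @: Q)%VS.
- apply/subvP=> _ /memv_imgP[_ /memv_imgP[y yQ ->] ->].
  rewrite evE -comp_lfunE -rhoM -evE memv_img //; by have [] := iQ x y yQ.
- case/eqP: v0; apply/eqP; rewrite -memv0 -N0; apply/NP=> x xQ.
  by apply/eqP; rewrite -memv0 -ev0 -evE memv_img.
have /memv_imgP[x xQ ->] : w \in (ev @: Q)%VS by rewrite evfull memvf.
by exists (rho x); rewrite ?memv_img // evE.
Qed.

(** Induction on [\dim Q], which is why all ideals are treated at once. A minimal left ideal [I] in
    [Q] accounts for [\dim I ^ 2], and the kernel [Q'] of its action on [Q] is a smaller ideal. If
    [\dim I = 1] its character joins [s]; otherwise [\dim I] joins [l]. *)
Theorem ideal_dim_sum_squares Q : semisimple_alg B -> ideal Q ->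
  exists (s : seq 'Hom(B, k^o)) (l : seq nat),
  [/\ uniq s,
      forall f, f \in s <-> alg_char f /\ (exists2 x, x \in Q & f x != 0),
      \dim Q = (size s + \sum_(d <- l) d ^ 2)%N
    & forall d, d \in l -> (1 < d)%N /\
        exists (V : vectType k) (rho : 'Hom(B, 'End(V))),
          irreducible_rep rho /\ \dim {:V} = d].
Proof.
move=> ssB; have [n] := ubnP (\dim Q); elim: n Q => // n IH Q ltQn iQ.
have [Q0|Q0] := eqVneq Q 0%VS.
  exists [::], [::]; split=> //; last by rewrite Q0 dimv0 big_nil.
  move=> f; split=> // -[_ [x]]; rewrite Q0 memv0 => /eqP->.
  by rewrite linear0 eqxx.
have /andP[lQ _] := iQ.
have [I mI IQ] := exists_minimal_left_ideal lQ Q0.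
have [lI I0 _] := mI; have irr := lid_rep_irreducible mI.
have [rI V0 _] := irr.
(* Semisimplicity enters here: were the action of [Q] on [I] zero, [Q'] would be [Q] and the
   induction would stall. *)
have rhoQ : exists2 x, x \in Q & lid_rep I x != 0.
  have [x xI rx] := semisimple_left_ideal_sqr ssB lI I0.
  by exists x => //; apply: (subvP IQ).
have dimQ := irreducible_ideal_dim irr iQ rhoQ.
rewrite dim_subvs in dimQ.
set Q' := (Q :&: lker (lid_rep I))%VS in dimQ.
have iQ' : ideal Q' := ideal_cap iQ (ideal_lker_rep rI).
have dI0 : (0 < \dim I)%N by rewrite lt0n dimv_eq0.
have ltQ' : (\dim Q' < n)%N.
  rewrite -ltnS; apply: leq_trans ltQn; rewrite ltnS dimQ -{1}[\dim Q']add0n ltn_add2r.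
  by rewrite expn_gt0 dI0.
have [s [l [us sP dimQ' lP]]] := IH Q' ltQ' iQ'.
have Q'Q : (Q' <= Q)%VS := capvSl _ _.
have [I1|I1] := eqVneq (\dim I) 1%N.
  have [f fchar fker] := line_ideal_char lI I1.
  have fQ : exists2 x, x \in Q & f x != 0.
    have [x xQ rx] := rhoQ; exists x => //.
    by rewrite -memv_ker fker memv_ker.
  exists (f :: s), l; split=> //=.
  - rewrite us andbT; apply/negP => /sP[_ [x]].
    by rewrite memv_cap -fker memv_ker => /andP[_ ->].
  - move=> g; rewrite in_cons; split.
      case/predU1P=> [->//|/sP[gc [x xQ' gx]]]; split=> //.
      by exists x => //; apply: (subvP Q'Q).
    move=> [gc gQ]; have [->//|gf] := eqVneq g f.
    (* A character [g] that vanishes on [Q'], which is now [Q :&: lker f], must equal [f]. *)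
    apply/sP; split=> //; apply: contrapT => gQ'.
    case/eqP: gf; apply/esym/(alg_char_eq_on_ideal iQ) => //.
    rewrite fker; apply/subvP=> x xQ'; rewrite memv_ker.
    by apply: contrapT => /negP gx; apply: gQ'; exists x.
  by rewrite dimQ I1 dimQ' addnA.
exists s, (\dim I :: l); split=> //.
- move=> g; split=> [/sP[gc [x xQ' gx]]|[gc gQ]].
    by split=> //; exists x => //; apply: (subvP Q'Q).
  apply/sP; split=> //; apply: contrapT => gQ'.
  have Q'g : (Q' <= lker g)%VS.
    apply/subvP=> x xQ'; rewrite memv_ker.
    by apply: contrapT => /negP gx; apply: gQ'; exists x.
  have iQg := ideal_cap iQ (ideal_lker_char gc).
  have ltQg : (\dim (Q :&: lker g) < \dim Q)%N.
    have [x xQ gx] := gQ; rewrite ltnNge; apply: contra gx => Qg.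
    have /eqP Qg' : (Q :&: lker g == Q)%VS by rewrite eqEdim capvSl.
    by move: xQ; rewrite -Qg' memv_cap memv_ker => /andP[].
  (* Suppose [g] vanishes on [Q']. If [Q :&: lker g] acts nontrivially on [I], it also has dimension
     at least [\dim I ^ 2 + \dim Q' = \dim Q], although it is proper in [Q]. If it acts trivially,
     it lies in [Q'], so [Q'] has codimension at most 1 in [Q] and [\dim I ^ 2 <= 1]. *)
  case: (pselect (exists2 x, x \in (Q :&: lker g)%VS & lid_rep I x != 0)) => [rg|rg].
    move: ltQg; rewrite (irreducible_ideal_dim irr iQg rg) dimQ dim_subvs.
    rewrite ltn_add2l ltnNge dimvS // subv_cap capvSr andbT subv_cap Q'Q.
    exact: Q'g.
  have QgQ' : (Q :&: lker g <= Q')%VS.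
    rewrite subv_cap capvSl; apply/subvP=> x xQg; rewrite memv_ker.
    by apply: contrapT => /negP rx; apply: rg; exists x.
  have : (\dim Q <= \dim Q' + 1)%N.
    rewrite -(limg_ker_dim g Q) leq_add ?dimvS //.
    by rewrite (leq_trans (dimvS (subvf _))) // dimvf.
  rewrite dimQ addnC leq_add2l -[X in (_ <= X)%N](exp1n 2) leq_exp2r //.
  by rewrite leqNgt ltn_neqAle eq_sym I1 dI0.
- by rewrite big_cons dimQ dimQ' addnCA.
move=> d; rewrite in_cons => /predU1P[->|/lP//]; split.
  by rewrite ltn_neqAle eq_sym I1.
by exists (subvs_of I), (lid_rep I); rewrite dim_subvs.
Qed.

End Closed.

(** * Grouplikes as characters of the dual *)

Section HopfCharacters.
Context {k : fieldType} {A : hopfAlgType k}.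
Local Notation E := (vbasis {:A}).

Definition dual_eval (x : A) : 'Hom(hopf_dual A, k^o) :=
  linfun (fun f : 'Hom(A, k^o) => f x).

Lemma dual_evalE x f : dual_eval x f = f x.
Proof. by rewrite linfun_linear //; exact: linear_eval. Qed.

Lemma dual_basisE i x : dual_basis i x = coord E i x :> k.
Proof. by rewrite lfunE. Qed.

Lemma dual_eval_inj : injective dual_eval.
Proof.
move=> x y xy; rewrite (coord_vbasis (memvf x)) (coord_vbasis (memvf y)).
by apply: eq_bigr => i _; rewrite -!dual_basisE -!dual_evalE xy.
Qed.

Lemma dual_eval_surj (phi : 'Hom(hopf_dual A, k^o)) : exists x, dual_eval x = phi.
Proof.
exists (\sum_(i < \dim {:A}) (phi (dual_basis i) : k) *: E`_i); apply/lfunP=> f.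
have fE : f = \sum_(i < \dim {:A}) (f E`_i : k) *: dual_basis i.
  apply/lfunP=> x; rewrite sum_lfunE [in LHS](coord_vbasis (memvf x)) linear_sum.
  apply: eq_bigr => i _; rewrite scale_lfunE linearZ /= dual_basisE.
  exact: mulrC.
rewrite dual_evalE [in RHS]fE !linear_sum; apply: eq_bigr => i _ /=.
by rewrite !linearZ /=; exact: mulrC.
Qed.

Lemma tscal_dual_basis i j (t : tensor A A) :
  tlift (tscal (dual_basis i) (dual_basis j)) t = t i j.
Proof.
have fE := basis_free (vbasisP {:A}).
rewrite /tlift (bigD1 i) //= (bigD1 j) //= big1 ?addr0 => [|j' nj]; last first.
  rewrite /tscal !dual_basisE !coord_free // (negPf nj) mulr0.
  exact: mulr0.
rewrite big1 ?addr0 => [|i' ni]; last first.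
  rewrite big1 // => j' _.
  rewrite /tscal !dual_basisE !coord_free // (negPf ni) mul0r.
  exact: mulr0.
rewrite /tscal !dual_basisE !coord_free // !eqxx mulr1; exact: mulr1.
Qed.

(** The product of the dual is convolution, so multiplicativity of evaluation at [g] says that
    [comul g] and [g ⊗ g] agree under all pairs of functionals, and dual basis pairs already read
    off every entry. The unit of the dual is [counit], whence the other condition. *)
Lemma grouplike_dual_eval g : grouplike A g <-> alg_char (dual_eval g).
Proof.
split=> [[Dg eg]|[g1 gM]].
  split=> [|u v]; first by rewrite dual_evalE.
  rewrite !dual_evalE; have -> : (u * v) g = tlift (tscal u v) (comul g).
    exact: dmulE.
  by rewrite Dg (tlift_pure _ _ (bilin_tscal u v)).
split; last by move: g1; rewrite dual_evalE.
apply/matrixP=> i j; rewrite -!tscal_dual_basis.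
rewrite (tlift_pure _ _ (bilin_tscal _ _)) -dmulE /tscal.
by have := gM (dual_basis i) (dual_basis j); rewrite !dual_evalE.
Qed.

End HopfCharacters.

(** * Traces of grouplikes *)

(** Write [M = C R] with [C] of full column rank and [R] of full row rank. Cancelling them in
    [C R C R = C R] gives [R C = 1], an identity matrix of size [\rank M], and [C R] and [R C] have
    the same trace. *)
Lemma mxtrace_idempotent (F : fieldType) n (M : 'M[F]_n) :
  M *m M = M -> \tr M = (\rank M)%:R.
Proof.
move=> MM; suff RC : row_base M *m col_base M = 1%:M.
  by rewrite -{1}(mulmx_base M) mxtrace_mulC RC mxtrace1.
have : col_base M *m (row_base M *m col_base M) *m row_base M =
       col_base M *m 1%:M *m row_base M.
  by rewrite mulmx1 mulmxA mulmx_base -mulmxA mulmx_base.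
move/(row_free_inj (row_base_free M)).
by move/(row_full_inj (col_base_full M)).
Qed.

Section TensorTrace.
Context {k : fieldType} {U V : vectType k}.
Local Notation EU := (vbasis {:U}).
Local Notation EV := (vbasis {:V}).

(** The trace in the basis of the [EU_i ⊗ EV_j]; [F] is a bare function, so composites can be used
    directly. *)
Definition tensor_trace (F : tensor U V -> tensor U V) : k :=
  \sum_(i < \dim {:U}) \sum_(j < \dim {:V}) F (EU`_i ⊗ EV`_j) i j.

Lemma eq_tensor_trace F G : F =1 G -> tensor_trace F = tensor_trace G.
Proof. by move=> FG; do 2!apply: eq_bigr => ? _; rewrite FG. Qed.

Lemma tensor_traceC (F G : tensor U V -> tensor U V) :
  linear F -> linear G -> tensor_trace (F \o G) = tensor_trace (G \o F).
Proof.
have expand (H K : tensor U V -> tensor U V) : linear H ->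
    tensor_trace (H \o K) =
    \sum_(i < \dim {:U}) \sum_(j < \dim {:V})
    \sum_(a < \dim {:U}) \sum_(b < \dim {:V})
      K (EU`_i ⊗ EV`_j) a b * H (EU`_a ⊗ EV`_b) i j.
  move=> H_lin; apply: eq_bigr => i _; apply: eq_bigr => j _ /=.
  rewrite -[K _](tlift_eta (U:=U)) (tlift_comp _ _ H_lin) summxE.
  apply: eq_bigr => a _; rewrite summxE; apply: eq_bigr => b _.
  by rewrite mxE tlift_eta.
move=> F_lin G_lin; rewrite !expand //.
under eq_bigr do rewrite exchange_big; rewrite exchange_big /=.
apply: eq_bigr => a _; under eq_bigr do rewrite exchange_big.
rewrite exchange_big /=; apply: eq_bigr => b _; apply: eq_bigr => i _.
by apply: eq_bigr => j _; rewrite mulrC.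
Qed.

End TensorTrace.

Lemma bilin_comp (k : fieldType) (U V U' V' : vectType k) (W : lmodType k)
    (f : U' -> V' -> W) (g : U -> U') (h : V -> V') :
  bilin f -> linear g -> linear h -> bilin (fun u v => f (g u) (h v)).
Proof.
by move=> [fl fr] gl hl; split=> [v a u u'|u a v v']; rewrite ?gl ?hl ?fl ?fr.
Qed.

Section RegularCharacter.
Context {k : fieldType} {A : falgType k}.
Local Notation E := (vbasis {:A}).
Local Notation amx x := (passmx.mxof E E (amull x)).

Definition reg_char (x : A) : k := \tr (amx x).

Lemma reg_charE x : reg_char x = \sum_i coord E i (x * E`_i).
Proof.
by apply: eq_bigr => i _; rewrite !mxE /= passmx.vecof_delta lfunE.
Qed.

Lemma reg_char1 : reg_char 1 = (\dim {:A})%:R.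
Proof.
by rewrite /reg_char amull1 passmx.mxof1 ?mxtrace1 // (basis_free (vbasisP _)).
Qed.

Lemma reg_char_linear : scalar reg_char.
Proof.
move=> a x y; rewrite !reg_charE mulr_sumr -big_split; apply: eq_bigr => i _.
by rewrite mulrDl -scalerAl linearP.
Qed.

(** [m] is the rank of left multiplication by [e]. An idempotent matrix of full rank is invertible,
    hence the identity, and left multiplication determines [e]. *)
Lemma reg_char_idempotent (e : A) : e * e = e ->
  exists m : nat, reg_char e = m%:R /\ (m = \dim {:A} -> e = 1).
Proof.
move=> ee; have EP : basis_of {:A} E := vbasisP _.
have MM : amx e *m amx e = amx e.
  rewrite -passmx.mxof_comp //; congr passmx.mxof.
  by apply/lfunP=> x; rewrite comp_lfunE !lfunE /= mulrA ee.
exists (\rank (amx e)); split; first exact: mxtrace_idempotent.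
move=> rk; have Mu : amx e \in unitmx by rewrite -row_free_unit -row_leq_rank rk.
have M1 : amx e = 1%:M by rewrite -(mulmxK Mu (amx e)) MM mulmxV.
apply: amull_inj; apply: (can_inj (passmx.mxofK EP EP)).
by rewrite M1 amull1 passmx.mxof1 ?(basis_free EP).
Qed.

End RegularCharacter.

Section GrouplikeTrace.
Context {k : fieldType} {A : hopfAlgType k}.
Local Notation E := (vbasis {:A}).
Implicit Types (h : 'End(A)) (x y g : A).

Lemma grouplike1 : grouplike A 1.
Proof. by split; [exact: comul1 | exact: counit1]. Qed.

Lemma bilin_mul_tensor x y : bilin (fun u v : A => (x * u) ⊗ (y * v)).
Proof.
by apply: bilin_comp bilin_pure _ _ => a u v; rewrite mulrDr scalerAr.
Qed.

Lemma comul_grouplikeM g x : grouplike A g ->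
  comul (g * x) = tlift (fun u v => (g * u) ⊗ (g * v)) (comul x).
Proof.
move=> [Dg _]; rewrite comulM Dg tlift_pure //.
split=> [v a u u'|u a v v'] /=; rewrite -tlift_comb; apply: eq_tlift => y z.
  by rewrite mulrDl -scalerAl (bilin_pure.1).
by rewrite mulrDl -scalerAl (bilin_pure.2).
Qed.

Lemma grouplikeM g g' : grouplike A g -> grouplike A g' -> grouplike A (g * g').
Proof.
move=> Gg [Dg' eg']; split; last by rewrite counitM Gg.2 eg' mulr1.
by rewrite comul_grouplikeM // Dg' tlift_pure //; exact: bilin_mul_tensor.
Qed.

Lemma grouplikeX g n : grouplike A g -> grouplike A (g ^+ n).
Proof.
move=> Gg; elim: n => [|n IH]; first exact: grouplike1.
by rewrite exprS; exact: grouplikeM.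
Qed.

(** The antipode axiom at a grouplike reads [antipode g * g = 1]. *)
Lemma grouplike_mulI g : grouplike A g -> injective ( *%R g).
Proof.
move=> [Dg eg]; apply: (can_inj (g := *%R (antipode g))) => x.
have := antipodel g; rewrite Dg eg tlift_pure; first last.
  split=> [v a u u'|u a v v']; first by rewrite linearP mulrDl -scalerAl.
  by rewrite mulrDr -scalerAr.
by rewrite scale1r mulrA => ->; rewrite mul1r.
Qed.

(** For [h] the identity, [twist h] is the Galois map [a ⊗ b |-> a1 ⊗ a2 b]; for [h] the antipode it
    is the inverse of that map. *)
Definition twist1 h (a b : A) : tensor A A :=
  tlift (fun a1 a2 => a1 ⊗ (h a2 * b)) (comul a).

Definition twist h : tensor A A -> tensor A A := tlift (twist1 h).

Lemma bilin_twist1 h : bilin (twist1 h).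
Proof.
split=> [b a u u'|u a b b']; rewrite /twist1 ?linearP -?tlift_comb //.
by apply: eq_tlift => x y; rewrite mulrDr -scalerAr (bilin_pure.2).
Qed.

(** By coassociativity, twists compose through the convolution product [e] of [h] and [h']. With the
    antipode axioms and [twist_counit], this inverts the Galois map. *)
Lemma twist_comp h h' (e : A -> A) :
   (forall x, tlift (fun x1 x2 => h x1 * h' x2) (comul x) = e x) ->
  forall t, twist h (twist h' t) =
    tlift (fun a b => tlift (fun a1 a2 => a1 ⊗ (e a2 * b)) (comul a)) t.
Proof.
move=> hh' t; rewrite /twist (tlift_comp _ _ (linear_tlift _)).
apply: eq_tlift => a b; rewrite (tlift_comp _ _ (linear_tlift _)).
under eq_tlift do rewrite (tlift_pure _ _ (bilin_twist1 h)).
pose G y : tensor A A -> tensor A A :=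
  fun z => y ⊗ tlift (fun u v => h u * (h' v * b)) z.
have bG : bilin G.
  split=> [v c u u'|u c v v']; rewrite /G ?linearP; first exact: bilin_pure.1.
  exact: bilin_pure.2.
have bH : bilin (fun u v => h u * (h' v * b)).
  split=> [v c u u'|u c v v']; rewrite linearP ?mulrDl -?scalerAl //.
  by rewrite mulrDr -scalerAr.
have := congr1 (tlift G) (comulA a); rewrite !(tlift_comp _ _ (linear_tlift G)).
under eq_tlift do rewrite (tlift_comp _ _ (linear_tlift G)).
under eq_tlift do under eq_tlift do
  rewrite (tlift_pure _ _ bG) /G (tlift_pure _ _ bH).
under [RHS]eq_tlift do rewrite (tlift_pure _ _ bG) /G.
rewrite /twist1 => ->; apply: eq_tlift => a1 a2; rewrite -hh'.
have mb : linear (fun x : A => x * b) by move=> c x y; rewrite mulrDl -scalerAl.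
by rewrite (tlift_comp _ _ mb); congr pure; apply: eq_tlift => x y; rewrite mulrA.
Qed.

Lemma twist_counit (t : tensor A A) :
  tlift (fun a b => tlift (fun a1 a2 => a1 ⊗ (((counit a2 : k) *: (1 : A)) * b))
    (comul a)) t = t.
Proof.
rewrite -[RHS]tlift_eta; apply: eq_tlift => a b.
have pb : linear (fun x : A => x ⊗ b) by move=> c x y; rewrite (bilin_pure.1).
rewrite -[in RHS](comul_counitr a) (tlift_comp _ _ pb).
apply: eq_tlift => x y; rewrite -scalerAl mul1r.
have := bilin_pure.2 x (counit y) b 0.
have := bilin_pure.1 b (counit y) x 0.
have p0 : x ⊗ (0 : A) = 0 by apply/matrixP=> i j; rewrite !mxE linear0 mulr0.
have p0' : (0 : A) ⊗ b = 0 by apply/matrixP=> i j; rewrite !mxE linear0 mul0r.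
by rewrite !addr0 p0 p0' !addr0 => -> ->.
Qed.

Definition lmul2 x y : tensor A A -> tensor A A :=
  tlift (fun u v => (x * u) ⊗ (y * v)).

Lemma tensor_trace_lmul2 x y :
  tensor_trace (lmul2 x y) = reg_char x * reg_char y.
Proof.
rewrite !reg_charE mulr_suml; apply: eq_bigr => i _.
rewrite mulr_sumr; apply: eq_bigr => j _.
by rewrite /lmul2 (tlift_pure _ _ (bilin_mul_tensor x y)) mxE.
Qed.

(* [twist id] conjugates [g (x) 1] into [g (x) g]. *)
Lemma reg_char_grouplike_sqr g : grouplike A g ->
  reg_char g * reg_char g = (\dim {:A})%:R * reg_char g.
Proof.
move=> Gg; rewrite mulrC -reg_char1 -[in RHS]mulrC -!tensor_trace_lmul2.
pose T := twist \1%VF; pose S := twist antipode.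
have TS t : T (S t) = t.
  rewrite /T /S (twist_comp (e := fun x => (counit x : k) *: 1)) ?twist_counit // => x.
  by rewrite -antipoder; apply: eq_tlift => u v; rewrite id_lfunE.
have ST t : S (T t) = t.
  rewrite /T /S (twist_comp (e := fun x => (counit x : k) *: 1)) ?twist_counit // => x.
  by rewrite -antipodel; apply: eq_tlift => u v; rewrite id_lfunE.
(* On [a ⊗ b] both sides are [g a1 ⊗ g a2 b], since [comul (g * a)] is [g a1 ⊗ g a2]. *)
have Tg t : T (lmul2 g 1 t) = lmul2 g g (T t).
  rewrite /T /twist /lmul2 !(tlift_comp _ _ (linear_tlift _)).
  apply: eq_tlift => a b; rewrite (tlift_pure _ _ (bilin_twist1 _)) /twist1.
  rewrite comul_grouplikeM // !(tlift_comp _ _ (linear_tlift _)).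
  apply: eq_tlift => u v; rewrite mul1r (tlift_pure _ _ (bilin_mul_tensor _ _)).
  rewrite tlift_pure ?id_lfunE ?mulrA //.
  split=> [y c x x'|x c y y']; first exact: bilin_pure.1.
  by rewrite !id_lfunE mulrDl -scalerAl (bilin_pure.2).
rewrite -(@eq_tensor_trace _ _ _ (T \o (lmul2 g 1 \o S))) => [|t /=]; last first.
  by rewrite Tg TS.
rewrite tensor_traceC; [|exact: linear_tlift|].
  by apply: eq_tensor_trace => t /=; rewrite ST.
move=> c x y /=; have -> : S (c *: x + y) = c *: S x + S y.
  exact: linear_tlift.
exact: linear_tlift.
Qed.

End GrouplikeTrace.

(** * Orders of grouplikes and the sum-of-squares equation for the dual *)

Lemma natr_inj_pchar0 (R : idomainType) :
  [pchar R] =i pred0 -> injective (fun n : nat => n%:R : R).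
Proof.
move=> /pcharf0P nat0 m n /eqP; wlog le_mn : m n / (m <= n)%N => [wlog|].
  by case: (leqP m n) => [/wlog//|/ltnW/wlog + mn]; rewrite eq_sym => /(_ mn).
by rewrite eq_sym -subr_eq0 -natrB // nat0 subn_eq0 => nm; apply/anti_leq/andP.
Qed.

(* By [reg_char_grouplike_sqr] each power of [g] has trace 0 or [dim A], so the
   trace of the idempotent [r^-1 (1 + g + ... + g^(r-1))] is [c dim A / r] with
   [c <= r] and equality only if this idempotent is 1. *)
Lemma prime_order_grouplike_dvd (k : fieldType) (A : hopfAlgType k)
    (r : nat) (g : A) :
  [pchar k] =i pred0 -> prime r -> grouplike A g -> g ^+ r = 1 -> g != 1 ->
  (r %| \dim {:A})%N.
Proof.
move=> char0 pr Gg gr g1; have natk := natr_inj_pchar0 char0.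
have /pcharf0P nat0 := char0.
have r0 : (r%:R : k) != 0.
  by rewrite nat0 -lt0n prime_gt0.
pose rcL := GRing.isLinear.Build k A k^o _ (reg_char : A -> k^o) reg_char_linear.
pose rc : {linear A -> k^o} := HB.pack (reg_char : A -> k^o) rcL.
set d := \dim {:A}; have d0 : (0 < d)%N by rewrite /d dimvf FalgType_proper.
pose e0 := \sum_(i < r) g ^+ i; pose e := (r%:R : k)^-1 *: e0.
have ge0 : g * e0 = e0.
  rewrite /e0 mulr_sumr; under eq_bigr do rewrite -exprS.
  case: (r) pr gr => // r' _ gr.
  by rewrite big_ord_recr big_ord_recl /= gr addrC expr0.
have gie0 n : g ^+ n * e0 = e0.
  by elim: n => [|n IH]; rewrite ?mul1r // exprS -mulrA IH.
have ee : e * e = e.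
  rewrite /e -scalerAl -scalerAr; congr (_ *: _).
  rewrite {1}/e0 mulr_suml; under eq_bigr do rewrite gie0.
  by rewrite sumr_const card_ord -scaler_nat scalerA mulVf // scale1r.
have [m [em md]] := reg_char_idempotent ee.
pose P := [pred i : 'I_r | reg_char (g ^+ i) != 0].
have tr0 : reg_char e0 = (#|P| * d)%:R.
  have -> : reg_char e0 = \sum_(i < r) reg_char (g ^+ i) by exact: (linear_sum rc).
  rewrite (bigID P) /= [X in _ + X]big1 ?addr0; last first.
    by move=> i; rewrite negbK => /eqP.
  rewrite natrM mulr_natl -sumr_const; apply: eq_bigr => i Pi.
  by apply: (mulIf Pi); rewrite reg_char_grouplike_sqr //; exact: grouplikeX.
have rm : (r * m)%N = (#|P| * d)%N.
  apply: natk; rewrite /= -tr0 natrM -em.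
  have -> : reg_char e = r%:R^-1 * reg_char e0 by exact: (linearZ_LR rc).
  by rewrite mulVKf.
have P0 : (0 < #|P|)%N.
  apply/card_gt0P; exists (Ordinal (prime_gt0 pr)).
  by rewrite inE /= expr0 reg_char1 nat0 -lt0n.
(* If [0 < #|P| < r], the prime [r] divides [#|P| * d] but not [#|P|]. If [#|P| = r], then [m = d],
   so [e = 1], and [g * e = e] forces [g = 1]. *)
have [Pr|Pr] := ltnP #|P| r.
  have : (r %| #|P| * d)%N by rewrite -rm dvdn_mulr.
  by rewrite Euclid_dvdM // gtnNdvd.
have {}Pr : #|P| = r.
  by apply/eqP; rewrite eqn_leq Pr andbT -[X in (_ <= X)%N]card_ord max_card.
case/eqP: g1; have e1 : e = 1.
  apply/md/eqP; rewrite -(eqn_pmul2l (prime_gt0 pr)) rm Pr //.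
by rewrite -[g]mulr1 -e1 /e -scalerAr ge0.
Qed.

(** Left multiplications permute [s], and finiteness makes a set of permutations that contains 1 and
    is closed under products a group. It has [size s] elements, so Cauchy's theorem applies to
    it. *)
Lemma cauchy_seq (R : nzRingType) (s : seq R) (r : nat) :
  uniq s -> 1 \in s -> {in s &, forall x y, x * y \in s} ->
  {in s, forall x, injective ( *%R x)} ->
  prime r -> (r %| size s)%N -> exists g, [/\ g \in s, g ^+ r = 1 & g != 1].
Proof.
move=> us s1 sM sI pr rs.
pose lm (x y : seq_sub s) : seq_sub s := SeqSub (sM _ _ (ssvalP x) (ssvalP y)).
have lmI x : injective (lm x).
  by move=> y z /(congr1 val) /= /(sI _ (ssvalP x)) yz; apply: val_inj.
pose L x := perm (@lmI x).
pose o : seq_sub s := SeqSub s1.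
have LX x n : ssval ((L x ^+ n)%g o) = ssval x ^+ n.
  elim: n => [|n IH]; first by rewrite expg0 perm1.
  by rewrite expgSr permM permE /= IH exprS.
have Linj : injective L.
  move=> x y Lxy; apply: val_inj; have := LX x 1%N; rewrite Lxy LX !expr1.
  exact: esym.
pose G := [set L x | x : seq_sub s].
have Ggroup : group_set G.
  apply/group_setP; split.
    apply/imsetP; exists o => //; apply/permP=> x; rewrite perm1 permE.
    by apply: val_inj; rewrite /= mul1r.
  move=> _ _ /imsetP[x _ ->] /imsetP[y _ ->]; apply/imsetP.
  (* Permutations multiply from left to right, so the factors are swapped. *)
  exists (lm y x) => //; apply/permP=> z; rewrite permM !permE.
  by apply: val_inj; rewrite /= mulrA.
have cG : #|group Ggroup| = size s.
  by rewrite /= card_imset // card_seq_sub.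
have [|x] := @Cauchy _ r (group Ggroup) pr; first by rewrite cG.
case/imsetP=> g _ ->{x} og; exists (ssval g); split; first exact: ssvalP.
  by rewrite -LX -og expg_order perm1.
apply: contraTneq (prime_gt1 pr) => g1; rewrite -og.
have -> : L g = 1%g.
  apply/permP=> x; rewrite perm1 permE; apply: val_inj.
  by rewrite /= g1 mul1r.
by rewrite order1.
Qed.

Lemma card_eq_seq (T : choiceType) (S : set T) (s : seq T) :
  uniq s -> (forall x, x \in s <-> S x) -> (S #= `I_(size s))%card.
Proof.
move=> us sS; pose F := [fset x in s]%fset.
have -> : S = [set` F]%classic by apply/seteqP; split=> x /=; rewrite inE => /sS.
by apply/card_eq_fsetP; rewrite card_fseq undup_id.
Qed.

Lemma dim_hopf_dual (k : fieldType) (A : hopfAlgType k) :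
  \dim {:hopf_dual A} = \dim {:A}.
Proof. by rewrite !dimvf /dim /= muln1. Qed.

(** The square count for the whole dual, its characters being carried back to grouplikes through the
    canonical bijection of [A] with its double dual. *)
Lemma grouplike_sum_squares (k : closedFieldType) (A : hopfAlgType k) :
  frobenius_type (hopf_dual A) ->
  exists (s : seq A) (l : seq nat),
  [/\ uniq s, forall x, x \in s <-> grouplike A x,
      \dim {:A} = (size s + \sum_(d <- l) d ^ 2)%N
    & forall d, d \in l -> (1 < d)%N /\ (d %| \dim {:A})%N].
Proof.
move=> [ssB frob].
have iB : ideal (fullv : {vspace hopf_dual A}).
  by apply/idealP=> x y _; rewrite !memvf.
have [s [l [us sP dimB lP]]] := ideal_dim_sum_squares ssB iB.
have [g gK] := choice (@dual_eval_surj k A).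
exists (map g s), l; split.
- by rewrite map_inj_uniq //; exact: (can_inj gK).
- move=> x; split=> [/mapP[f /sP[fc _] ->]|Gx].
    by apply/grouplike_dual_eval; rewrite gK.
  have xs : dual_eval x \in s.
    have xc := (grouplike_dual_eval x).1 Gx; apply/sP; split=> //.
    exists 1; rewrite ?memvf //; have [-> _] := xc; exact: oner_neq0.
  by apply/mapP; exists (dual_eval x) => //; apply: dual_eval_inj; rewrite gK.
- by rewrite size_map -dimB dim_hopf_dual.
move=> d dl; have [d1 [V [rho [irr dV]]]] := lP d dl; split=> //.
by rewrite -dV -dim_hopf_dual (frob V rho).
Qed.

(** * Arithmetic in dimension [p q] *)

Theorem proposition2p3 (k : closedFieldType) (p q : nat) (A : hopfAlgType k)
    (char0 : [pchar k] =i pred0)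
    (p_prime : prime p) (q_prime : prime q) (lt_pq : (p < q)%N)
    (dimA : \dim {:A} = (p * q)%N)
    (ssA : semisimple_alg A)
    (frobA : frobenius_type (hopf_dual A)) :
  ((grouplike A #= `I_p)%card /\ q = 1 %[mod p]) \/
  (grouplike A #= `I_(p * q))%card.
Proof.
have [s [l [us sP dims lP]]] := grouplike_sum_squares frobA.
have card_s := card_eq_seq us sP; set n := size s in dims card_s.
have p0 := prime_gt0 p_prime; have q0 := prime_gt0 q_prime.
have pNq : ~~ (p %| q)%N by rewrite dvdn_prime2 // neq_ltn lt_pq.
have [a dim_a] : exists a, (p * q = n + a * p ^ 2)%N.
  (* [d ^ 2 <= p q < q ^ 2] gives [d < q], so [d] is coprime to [q]; hence [d > 1] divides the prime
     [p]. *)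
  have lp d : d \in l -> d = p.
    move=> dl; have [d1 dvd] := lP d dl.
    have dq : (d < q)%N.
      rewrite ltnNge; apply/negP=> qd.
      have : (d ^ 2 <= p * q)%N.
        rewrite -dimA dims (big_rem d) //= addnCA leq_addr //.
      rewrite leqNgt -mulnn => /negP; apply.
      by apply: leq_trans (leq_mul qd qd); rewrite ltn_pmul2r.
    have dCq : coprime d q.
      rewrite coprime_sym prime_coprime //; apply/negP.
      by move=> /(dvdn_leq (ltnW d1)); rewrite leqNgt dq.
    move: dvd; rewrite dimA Gauss_dvdl // => dp.
    by move: p_prime => /primeP[_ /(_ d dp) /pred2P[d0|//]]; rewrite d0 in d1.
  exists (size l); rewrite -dimA dims; congr addn.
  rewrite (eq_big_seq (fun=> p ^ 2)%N) => [|d /lp->//].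
  by rewrite big_const_seq count_predT iter_addn_0 mulnC.
have sM : {in s &, forall x y, x * y \in s}.
  by move=> x y /sP Gx /sP Gy; apply/sP/grouplikeM.
have sI : {in s, forall x, injective ( *%R x)}.
  by move=> x /sP Gx; apply: grouplike_mulI.
have s1 : 1 \in s by apply/sP/grouplike1.
have pn : (p %| n)%N.
  by rewrite -(@dvdn_addl (a * p ^ 2)) ?dvdn_mull ?dvdn_exp // -dim_a dvdn_mulr.
have [m nE] : exists m, n = (p * m)%N by case/dvdnP: pn => m ->; exists m; rewrite mulnC.
have qE : (q = m + a * p)%N.
  by apply/eqP; rewrite -(eqn_pmul2l p0) dim_a nE mulnDr mulnCA -mulnn.
have [m1|m1] := eqVneq m 1%N.
  left; split; first by move: card_s; rewrite nE m1 muln1.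
  by rewrite qE m1 addnC modnMDl.
right; suff mq : m = q by move: card_s; rewrite nE mq.
pose r := pdiv m.
have m0 : (0 < m)%N.
  by rewrite lt0n; apply: contraNneq pNq => m0; rewrite qE m0 dvdn_mull.
have pr : prime r by rewrite pdiv_prime // ltn_neqAle eq_sym m1.
have rm : (r %| m)%N := pdiv_dvd m.
have rn : (r %| size s)%N by rewrite -/n nE dvdn_mull.
have [g [/sP Gg gr g1]] := cauchy_seq us s1 sM sI pr rn.
have := prime_order_grouplike_dvd char0 pr Gg gr g1.
rewrite dimA Euclid_dvdM // !dvdn_prime2 // => /orP[/eqP rp|/eqP rq].
  (* [r = p] would make [p] divide [m + a p = q]. Otherwise [q = r <= m <= m + a p = q]. *)
  by case/negP: pNq; rewrite qE dvdn_addl -rp // dvdn_mull.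
apply/eqP; rewrite eqn_leq -{2}rq (dvdn_leq m0 rm) andbT.
by rewrite qE leq_addr.
Qed.
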